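(* Let $\nu$ be a real number and let $\varphi$ be a parabolic linear fractional self-map of the open unit disk $\mathbb{D}$ that is not an automorphism of $\mathbb{D}$. Then the composition operator $C_\varphi$, $C_\varphi f=f\circ\varphi$, is not recurrent on $S_\nu$.
   Context: For $\nu\in\mathbb{R}$, the weighted Dirichlet space $S_\nu$ is the Hilbert space of functions $f(z)=\sum_{n=0}^\infty a_nz^n$ analytic on $\mathbb{D}$ with $\|f\|_\nu^2=\sum_{n=0}^\infty |a_n|^2(n+1)^{2\nu}<\infty$. If $\varphi$ is a linear fractional map taking $\mathbb{D}$ into itself, then $C_\varphi$ is a bounded operator on every $S_\nu$. A linear fractional map $\varphi$ with $\varphi(\mathbb{D})\subset\mathbb{D}$, not the identity, is parabolic if it has exactly one fixed point in the Riemann sphere and that fixed point lies on the unit circle; it is an automorphism if $\varphi(\mathbb{D})=\mathbb{D}$. A bounded operator $T$ on a Banach space $X$ is recurrent if for every nonempty open set $U\subset X$ there is a positive integer $k$ with $U\cap T^{-k}(U)\neq\emptyset$ (equivalently, the set of vectors $x$ for which there is a strictly increasing sequence of positive integers $(k_n)$ with $T^{k_n}x\to x$ is dense in $X$). *)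

(* Defs.v *)
From Stdlib Require Import Reals Lra FunctionalExtensionality ProofIrrelevance.
From Coquelicot Require Export Coquelicot.

Open Scope R_scope.

Definition disk : Type := {z : C | Cmod z < 1}.

Definition disk_val (z : disk) : C := proj1_sig z.
Coercion disk_val : disk >-> C.

Record lft : Type := Lft {
  lft_a : C; lft_b : C; lft_c : C; lft_d : C;
  lft_det : (lft_a * lft_d - lft_b * lft_c <> 0)%C
}.

(* On the finite plane.  This is the intended value only where the denominator
   does not vanish, since division by zero is a total operation here. *)
Definition lft_num (phi : lft) (z : C) : C := (lft_a phi * z + lft_b phi)%C.
Definition lft_den (phi : lft) (z : C) : C := (lft_c phi * z + lft_d phi)%C.
Definition lft_eval (phi : lft) (z : C) : C := (lft_num phi z / lft_den phi z)%C.

(* The Riemann sphere; [None] is the point at infinity. *)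
Definition sphere : Type := option C.

Definition lft_sphere (phi : lft) (p : sphere) : sphere :=
  match p with
  | Some z => if Ceq_dec (lft_den phi z) 0 then None else Some (lft_eval phi z)
  | None => if Ceq_dec (lft_c phi) 0 then None else Some (lft_a phi / lft_c phi)%C
  end.

Definition sphere_disk (p : sphere) : Prop :=
  exists z : C, p = Some z /\ Cmod z < 1.

Definition self_map_of_disk (phi : lft) : Prop :=
  forall p : sphere, sphere_disk p -> sphere_disk (lft_sphere phi p).

Definition automorphism_of_disk (phi : lft) : Prop :=
  forall q : sphere,
    sphere_disk q <-> exists p : sphere, sphere_disk p /\ lft_sphere phi p = q.

Definition parabolic (phi : lft) : Prop :=
  exists zeta : C, Cmod zeta = 1 /\
    forall p : sphere, lft_sphere phi p = p <-> p = Some zeta.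

Lemma self_map_den_neq_0 (phi : lft) (z : C) :
  self_map_of_disk phi -> Cmod z < 1 -> lft_den phi z <> 0%C.
Proof.
  intros H Hz.
  destruct (H (Some z)) as [w [Hw _]].
  - exists z; auto.
  - simpl in Hw. destruct (Ceq_dec (lft_den phi z) 0); congruence.
Qed.

Lemma self_map_eval_lt_1 (phi : lft) (z : C) :
  self_map_of_disk phi -> Cmod z < 1 -> Cmod (lft_eval phi z) < 1.
Proof.
  intros H Hz.
  destruct (H (Some z)) as [w [Hw Hw1]].
  - exists z; auto.
  - simpl in Hw. destruct (Ceq_dec (lft_den phi z) 0); congruence.
Qed.

Definition disk_map (phi : lft) (Hphi : self_map_of_disk phi) (z : disk) : disk :=
  exist (fun w : C => Cmod w < 1) (lft_eval phi z)
    (self_map_eval_lt_1 phi z Hphi (proj2_sig z)).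

Definition weight (nu : R) (n : nat) : R := Rpower (INR (n + 1)) (2 * nu).

Definition wterm (nu : R) (a : nat -> C) (n : nat) : R :=
  (Cmod (a n)) ^ 2 * weight nu n.

(* The coefficient sequence is determined by the function (see [dirichlet_ext]); it
   is stored so that the norm needs no choice. *)
Record dirichlet (nu : R) : Type := Dirichlet {
  dfun :> disk -> C;
  dcoef : nat -> C;
  dfun_expansion : forall z : disk, is_pseries dcoef (z : C) (dfun z);
  dcoef_summable : ex_series (wterm nu dcoef)
}.
Arguments Dirichlet {nu}.
Arguments dfun {nu}.
Arguments dcoef {nu}.
Arguments dfun_expansion {nu}.
Arguments dcoef_summable {nu}.

Definition dnorm {nu : R} (f : dirichlet nu) : R :=
  sqrt (Series (wterm nu (dcoef f))).

Lemma dirichlet_eq (nu : R) (f g : dirichlet nu) :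
  (forall n, dcoef f n = dcoef g n) -> f = g.
Proof.
  intros H.
  destruct f as [f a Hf Ha], g as [g b Hg Hb]; simpl in H.
  assert (a = b) by (apply functional_extensionality; exact H); subst b.
  assert (f = g).
  { apply functional_extensionality; intros z.
    exact (filterlim_locally_unique _ _ _ (Hf z) (Hg z)). }
  subst g.
  f_equal; apply proof_irrelevance.
Qed.

Lemma is_pseries_C_real (p : C -> R) (a : nat -> C) (x : R) :
  (forall u v : C, p (u + v)%C = p u + p v) ->
  (forall (r : R) (u : C), p (r * u)%C = r * p u) ->
  (forall u : C, Rabs (p u) <= Cmod u) ->
  @is_pseries C_AbsRing C_NormedModule a (RtoC x) (RtoC 0) ->
  @is_pseries R_AbsRing R_NormedModule (fun n => p (a n)) x 0.
Proof.
  intros Hadd Hscal Hbd H.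
  assert (Hsum : forall n,
    sum_n (fun k => scal (pow_n x k) (p (a k))) n
    = p (sum_n (fun k => scal (pow_n (RtoC x : C_AbsRing) k) (a k)) n)).
  { assert (Hterm : forall k,
      scal (pow_n x k) (p (a k))
      = p (scal (pow_n (RtoC x : C_AbsRing) k) (a k : C_NormedModule))).
    { intros k.
      assert (E : pow_n (RtoC x : C_AbsRing) k = RtoC (pow_n x k)).
      { induction k as [|k IH]; [reflexivity|].
        simpl; rewrite IH. symmetry; apply RtoC_mult. }
      rewrite E. symmetry; apply Hscal. }
    induction n as [|n IH].
    - rewrite !sum_O; apply Hterm.
    - rewrite !sum_Sn, IH, Hterm. symmetry; apply Hadd. }
  unfold is_pseries, is_series.
  apply filterlim_ext with (1 := fun n => eq_sym (Hsum n)).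
  apply (filterlim_locally (U := R_UniformSpace)); intros eps.
  assert (H' := proj1 (filterlim_locally_ball_norm _ _) H eps).
  revert H'; apply filter_imp; intros n Hn.
  unfold ball_norm in Hn.
  apply (norm_compat1 (V := R_NormedModule)).
  set (s := sum_n _ n) in *.
  change (Rabs (p s - 0) < eps).
  rewrite Rminus_0_r.
  apply Rle_lt_trans with (1 := Hbd s).
  replace (minus s (RtoC 0)) with (s : C) in Hn
    by (change ((s : C) = ((s : C) - 0)%C); ring).
  exact Hn.
Qed.

Lemma pseries_0_coef (b : nat -> R) :
  (forall x, Rabs x < 1 -> @is_pseries R_AbsRing R_NormedModule b x 0) -> forall n, b n = 0.
Proof.
  intros H n.
  assert (Hr : Rbar_lt 0 (CV_radius b)).
  { apply Rbar_lt_le_trans with (1 / 2); [simpl; lra|].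
    apply Rbar_not_lt_le; intros Hlt.
    apply (CV_disk_outside b (1 / 2)).
    - rewrite Rabs_pos_eq by lra; exact Hlt.
    - assert (Hh : ex_series (fun k => b k * (1 / 2) ^ k)).
      { apply ex_pseries_R. exists 0. apply H. rewrite Rabs_pos_eq; lra. }
      exact (ex_series_lim_0 _ Hh). }
  apply (PSeries_ext_recip b (fun _ => 0) n Hr).
  - rewrite CV_radius_const_0. exact I.
  - exists (mkposreal 1 Rlt_0_1); intros x Hx.
    rewrite PSeries_const_0.
    apply is_pseries_unique, H.
    change (Rabs (x - 0) < 1) in Hx. rewrite Rminus_0_r in Hx. exact Hx.
Qed.

Lemma dirichlet_ext (nu : R) (f g : dirichlet nu) :
  (forall z : disk, f z = g z) -> f = g.
Proof.
  intros Hfg. apply dirichlet_eq.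
  set (d := fun n => (dcoef f n - dcoef g n)%C).
  assert (Hd : forall x : R, Rabs x < 1 ->
    @is_pseries C_AbsRing C_NormedModule d (RtoC x) (RtoC 0)).
  { intros x Hx.
    assert (Hz : Cmod (RtoC x) < 1) by (rewrite Cmod_R; exact Hx).
    set (z := exist (fun w : C => Cmod w < 1) (RtoC x) Hz : disk).
    replace (RtoC 0) with (f z - g z)%C by (rewrite Hfg; ring).
    exact (@is_pseries_minus C_AbsRing C_NormedModule _ _ _ _ _
             (dfun_expansion f z) (dfun_expansion g z)). }
  intros n.
  assert (Hre : Re (d n) = 0).
  { apply (pseries_0_coef (fun k => Re (d k))); intros x Hx.
    apply is_pseries_C_real; [| | | apply Hd, Hx].
    - reflexivity.
    - intros r u; unfold Re; simpl; ring.
    - intros u. apply re_le_Cmod. }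
  assert (Him : Im (d n) = 0).
  { apply (pseries_0_coef (fun k => Im (d k))); intros x Hx.
    apply is_pseries_C_real; [| | | apply Hd, Hx].
    - reflexivity.
    - intros r u; unfold Im; simpl; ring.
    - intros u; eapply Rle_trans; [apply Rmax_r | apply Rmax_Cmod]. }
  assert (E : d n = 0%C) by (apply injective_projections; assumption).
  unfold d in E.
  replace (dcoef f n) with (dcoef f n - dcoef g n + dcoef g n)%C by ring.
  rewrite E; ring.
Qed.

Lemma weight_pos (nu : R) (n : nat) : 0 < weight nu n.
Proof. apply exp_pos. Qed.

Lemma wterm_ge_0 (nu : R) (a : nat -> C) (n : nat) : 0 <= wterm nu a n.
Proof.
  apply Rmult_le_pos; [apply pow2_ge_0 | apply Rlt_le, weight_pos].
Qed.

Lemma wterm_plus_le (nu : R) (a b : nat -> C) (t : R) (n : nat) :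
  0 < t ->
  wterm nu (fun k => (a k + b k)%C) n
  <= (1 + t) * wterm nu a n + (1 + / t) * wterm nu b n.
Proof.
  intros Ht; unfold wterm.
  assert (Hw := weight_pos nu n).
  set (w := weight nu n) in *.
  assert (Hs := Cmod_triangle (a n) (b n)).
  assert (H0 := Cmod_ge_0 (a n + b n)%C).
  set (x := Cmod (a n)) in *; set (y := Cmod (b n)) in *.
  set (s := Cmod (a n + b n)%C) in *.
  assert (s ^ 2 <= (x + y) ^ 2) by (apply pow_incr; lra).
  assert (Hsq : (1 + t) * x ^ 2 + (1 + / t) * y ^ 2 - (x + y) ^ 2
                = / t * (t * x - y) ^ 2) by (field; lra).
  assert (0 <= / t * (t * x - y) ^ 2).
  { apply Rmult_le_pos; [apply Rlt_le, Rinv_0_lt_compat; lra | apply pow2_ge_0]. }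
  replace ((1 + t) * (x ^ 2 * w) + (1 + / t) * (y ^ 2 * w))
    with (((1 + t) * x ^ 2 + (1 + / t) * y ^ 2) * w) by ring.
  apply Rmult_le_compat_r; lra.
Qed.

Lemma ex_series_wterm_bound (nu : R) (a b : nat -> C) (t : R) :
  ex_series (wterm nu a) -> ex_series (wterm nu b) ->
  ex_series (fun n => (1 + t) * wterm nu a n + (1 + / t) * wterm nu b n).
Proof.
  intros Ha Hb.
  apply (ex_series_plus (fun n => (1 + t) * wterm nu a n)
                        (fun n => (1 + / t) * wterm nu b n)).
  - exact (ex_series_scal (1 + t) _ Ha).
  - exact (ex_series_scal (1 + / t) _ Hb).
Qed.

Lemma ex_series_wterm_plus (nu : R) (a b : nat -> C) :
  ex_series (wterm nu a) -> ex_series (wterm nu b) ->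
  ex_series (wterm nu (fun k => (a k + b k)%C)).
Proof.
  intros Ha Hb.
  refine (@ex_series_le _ R_CompleteNormedModule _ _ _
            (ex_series_wterm_bound nu a b 1 Ha Hb)).
  intros n.
  change (Rabs (wterm nu (fun k => (a k + b k)%C) n)
          <= (1 + 1) * wterm nu a n + (1 + / 1) * wterm nu b n).
  rewrite Rabs_pos_eq by apply wterm_ge_0.
  apply wterm_plus_le; lra.
Qed.

Lemma wterm_scal (nu : R) (l : C) (a : nat -> C) (n : nat) :
  wterm nu (fun k => (l * a k)%C) n = Cmod l ^ 2 * wterm nu a n.
Proof. unfold wterm; rewrite Cmod_mult; ring. Qed.

Lemma ex_series_wterm_scal (nu : R) (l : C) (a : nat -> C) :
  ex_series (wterm nu a) -> ex_series (wterm nu (fun k => (l * a k)%C)).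
Proof.
  intros Ha.
  apply ex_series_ext with (fun n => Cmod l ^ 2 * wterm nu a n).
  - intros n; symmetry; apply wterm_scal.
  - exact (ex_series_scal (Cmod l ^ 2) _ Ha).
Qed.

Lemma is_pseries_C_plus (a b : nat -> C) (z la lb : C) :
  is_pseries a z la -> is_pseries b z lb ->
  is_pseries (fun n => (a n + b n)%C) z (la + lb)%C.
Proof. exact (@is_pseries_plus C_AbsRing C_NormedModule a b z la lb). Qed.

Lemma is_pseries_C_scal (l : C) (a : nat -> C) (z la : C) :
  is_pseries a z la -> is_pseries (fun n => (l * a n)%C) z (l * la)%C.
Proof.
  apply (@is_pseries_scal C_AbsRing C_NormedModule l a z la).
  apply Cmult_comm.
Qed.

Lemma is_pseries_C_0 (z : C) :
  @is_pseries C_AbsRing C_NormedModule (fun _ : nat => RtoC 0) z (RtoC 0).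
Proof.
  unfold is_pseries, is_series.
  apply filterlim_ext with (fun _ : nat => (0%C : C)).
  - intros n; symmetry.
    induction n as [|n IH].
    + rewrite sum_O. exact (Cmult_0_r _).
    + rewrite sum_Sn, IH. change (0 + pow_n z (S n) * 0 = 0 :> C)%C. ring.
  - apply filterlim_const.
Qed.

Lemma is_series_R_0 : @is_series R_AbsRing R_NormedModule (fun _ => 0) 0.
Proof.
  unfold is_series.
  apply filterlim_ext with (fun _ : nat => 0).
  - intros n; rewrite sum_n_const. exact (eq_sym (Rmult_0_r _)).
  - apply filterlim_const.
Qed.

Definition dzero (nu : R) : dirichlet nu.
Proof.
  refine (Dirichlet (fun _ => 0%C) (fun _ => 0%C) (fun z => is_pseries_C_0 z) _).
  apply ex_series_ext with (fun _ => 0).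
  - intros n; unfold wterm; rewrite Cmod_0.
    change (0 = 0 ^ 2 * weight nu n :> R). ring.
  - exact (ex_intro _ 0 is_series_R_0).
Defined.

Definition dplus {nu : R} (f g : dirichlet nu) : dirichlet nu :=
  Dirichlet (fun z => (f z + g z)%C) (fun n => (dcoef f n + dcoef g n)%C)
    (fun z => is_pseries_C_plus _ _ _ _ _ (dfun_expansion f z) (dfun_expansion g z))
    (ex_series_wterm_plus _ _ _ (dcoef_summable f) (dcoef_summable g)).

Definition dscal {nu : R} (l : C) (f : dirichlet nu) : dirichlet nu :=
  Dirichlet (fun z => (l * f z)%C) (fun n => (l * dcoef f n)%C)
    (fun z => is_pseries_C_scal _ _ _ _ (dfun_expansion f z))
    (ex_series_wterm_scal _ _ _ (dcoef_summable f)).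

Definition dopp {nu : R} (f : dirichlet nu) : dirichlet nu := dscal (-(1))%C f.

Section NormedSpace.
Variable nu : R.

Definition dirichlet_AbelianMonoid_mixin : AbelianMonoid.mixin_of (dirichlet nu).
Proof.
  apply (AbelianMonoid.Mixin (dirichlet nu) dplus (dzero nu));
    intros; apply dirichlet_eq; intros n; simpl; ring.
Defined.

Canonical dirichlet_AbelianMonoid :=
  AbelianMonoid.Pack (dirichlet nu) dirichlet_AbelianMonoid_mixin (dirichlet nu).

Definition dirichlet_AbelianGroup_mixin :
  AbelianGroup.mixin_of dirichlet_AbelianMonoid.
Proof.
  apply (AbelianGroup.Mixin dirichlet_AbelianMonoid dopp).
  intros f; apply dirichlet_eq; intros n; simpl; ring.
Defined.

Canonical dirichlet_AbelianGroup :=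
  AbelianGroup.Pack (dirichlet nu)
    (AbelianGroup.Class _ _ dirichlet_AbelianGroup_mixin) (dirichlet nu).

Definition dirichlet_ModuleSpace_mixin :
  ModuleSpace.mixin_of C_Ring dirichlet_AbelianGroup.
Proof.
  apply (ModuleSpace.Mixin C_Ring dirichlet_AbelianGroup dscal);
    intros; apply dirichlet_eq; intros n; simpl;
    unfold mult, one, plus; simpl; ring.
Defined.

Canonical dirichlet_ModuleSpace :=
  ModuleSpace.Pack C_Ring (dirichlet nu)
    (ModuleSpace.Class _ _ _ dirichlet_ModuleSpace_mixin) (dirichlet nu).

Lemma Series_wterm_ge_0 (f : dirichlet nu) : 0 <= Series (wterm nu (dcoef f)).
Proof.
  replace 0 with (Series (fun _ => 0)).
  - apply Series_le.
    + intros n; split; [lra | apply wterm_ge_0].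
    + apply dcoef_summable.
  - apply is_series_unique. exact is_series_R_0.
Qed.

Lemma dnorm_ge_0 (f : dirichlet nu) : 0 <= dnorm f.
Proof. apply sqrt_pos. Qed.

Lemma dnorm_sqr (f : dirichlet nu) : dnorm f ^ 2 = Series (wterm nu (dcoef f)).
Proof. apply pow2_sqrt, Series_wterm_ge_0. Qed.

Lemma dnorm_triangle (f g : dirichlet nu) : dnorm (dplus f g) <= dnorm f + dnorm g.
Proof.
  apply le_epsilon; intros eps Heps.
  set (al := dnorm f + eps / 2); set (be := dnorm g + eps / 2).
  assert (Hf := dnorm_ge_0 f); assert (Hg := dnorm_ge_0 g).
  assert (Hal : 0 < al) by (unfold al; lra).
  assert (Hbe : 0 < be) by (unfold be; lra).
  set (t := be / al).
  assert (Ht : 0 < t) by (apply Rdiv_lt_0_compat; assumption).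
  assert (Hit : 0 < / t) by (apply Rinv_0_lt_compat; assumption).
  assert (H : dnorm (dplus f g) ^ 2
              <= (1 + t) * dnorm f ^ 2 + (1 + / t) * dnorm g ^ 2).
  { rewrite !dnorm_sqr.
    assert (E : Series (fun n => (1 + t) * wterm nu (dcoef f) n
                               + (1 + / t) * wterm nu (dcoef g) n)
                = (1 + t) * Series (wterm nu (dcoef f))
                  + (1 + / t) * Series (wterm nu (dcoef g))).
    { rewrite <- !Series_scal_l.
      apply Series_plus;
        [exact (ex_series_scal (1 + t) _ (dcoef_summable f))
        | exact (ex_series_scal (1 + / t) _ (dcoef_summable g))]. }
    rewrite <- E.
    apply Series_le.
    - intros n; split; [apply wterm_ge_0 | apply wterm_plus_le, Ht].
    - apply ex_series_wterm_bound; apply dcoef_summable. }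
  assert (H1 : dnorm f ^ 2 <= al ^ 2) by (apply pow_incr; unfold al; lra).
  assert (H2 : dnorm g ^ 2 <= be ^ 2) by (apply pow_incr; unfold be; lra).
  assert (H3 : (1 + t) * al ^ 2 + (1 + / t) * be ^ 2 = (al + be) ^ 2)
    by (unfold t; field; lra).
  assert (H4 : (1 + t) * dnorm f ^ 2 <= (1 + t) * al ^ 2)
    by (apply Rmult_le_compat_l; lra).
  assert (H5 : (1 + / t) * dnorm g ^ 2 <= (1 + / t) * be ^ 2)
    by (apply Rmult_le_compat_l; lra).
  replace (dnorm f + dnorm g + eps) with (al + be) by (unfold al, be; field).
  apply Rsqr_incr_0; [unfold Rsqr; lra | apply dnorm_ge_0 | lra].
Qed.

Lemma dnorm_scal (l : C) (f : dirichlet nu) : dnorm (dscal l f) = Cmod l * dnorm f.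
Proof.
  unfold dnorm; simpl.
  rewrite (Series_ext _ (fun n => Cmod l ^ 2 * wterm nu (dcoef f) n))
    by (intros n; apply wterm_scal).
  rewrite Series_scal_l, sqrt_mult_alt by apply pow2_ge_0.
  rewrite sqrt_pow2 by apply Cmod_ge_0. reflexivity.
Qed.

Lemma dnorm_eq_0 (f : dirichlet nu) : dnorm f = 0 -> f = dzero nu.
Proof.
  intros H; apply dirichlet_eq; intros n; simpl.
  assert (HS : Series (wterm nu (dcoef f)) = 0) by (rewrite <- dnorm_sqr, H; ring).
  assert (Hn : wterm nu (dcoef f) n <= 0).
  { rewrite <- HS.
    assert (Hle : forall m, sum_n (wterm nu (dcoef f)) m
                            <= Series (wterm nu (dcoef f))).
    { intros m.
      apply (is_lim_seq_incr_compare _ _ (Series_correct _ (dcoef_summable f))).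
      intros k; rewrite sum_Sn. unfold plus; simpl.
      assert (Hk := wterm_ge_0 nu (dcoef f) (S k)); lra. }
    apply Rle_trans with (2 := Hle n).
    destruct n as [|n]; [rewrite sum_O; lra|].
    rewrite sum_Sn. unfold plus; simpl.
    assert (0 <= sum_n (wterm nu (dcoef f)) n).
    { clear; induction n as [|n IH].
      - rewrite sum_O; apply wterm_ge_0.
      - rewrite sum_Sn. unfold plus; simpl.
        assert (Hk := wterm_ge_0 nu (dcoef f) (S n)); lra. }
    lra. }
  assert (Hw := weight_pos nu n).
  apply Cmod_eq_0.
  assert (H0 := Cmod_ge_0 (dcoef f n)).
  unfold wterm in Hn.
  destruct (Req_dec (Cmod (dcoef f n)) 0) as [E|E]; [exact E|exfalso].
  assert (0 < Cmod (dcoef f n) ^ 2) by (apply pow_lt; lra).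
  assert (0 < Cmod (dcoef f n) ^ 2 * weight nu n)
    by (apply Rmult_lt_0_compat; assumption).
  lra.
Qed.

Definition dball (f : dirichlet nu) (eps : R) (g : dirichlet nu) : Prop :=
  dnorm (minus g f : dirichlet nu) < eps.

Definition dirichlet_UniformSpace_mixin : UniformSpace.mixin_of (dirichlet nu).
Proof.
  apply (UniformSpace.Mixin (dirichlet nu) (dzero nu) dball).
  - intros f e; unfold dball.
    replace (minus f f) with (dscal 0%C f)
      by (apply dirichlet_eq; intros n; simpl; ring).
    rewrite dnorm_scal, Cmod_0. destruct e as [e He]; simpl; lra.
  - intros f g e; unfold dball; intros H.
    replace (minus f g) with (dscal (-(1))%C (minus g f))
      by (apply dirichlet_eq; intros n; simpl; ring).
    rewrite dnorm_scal, Cmod_opp, Cmod_1. lra.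
  - intros f g h e1 e2; unfold dball; intros H1 H2.
    replace (minus h f) with (dplus (minus g f) (minus h g))
      by (apply dirichlet_eq; intros n; simpl; ring).
    assert (H := dnorm_triangle (minus g f) (minus h g)); lra.
Defined.

Canonical dirichlet_UniformSpace :=
  UniformSpace.Pack (dirichlet nu) dirichlet_UniformSpace_mixin (dirichlet nu).

Canonical dirichlet_NormedModuleAux :=
  NormedModuleAux.Pack C_AbsRing (dirichlet nu)
    (NormedModuleAux.Class C_AbsRing (dirichlet nu)
       (ModuleSpace.class _ dirichlet_ModuleSpace)
       dirichlet_UniformSpace_mixin) (dirichlet nu).

Definition dirichlet_NormedModule_mixin :
  NormedModule.mixin_of C_AbsRing dirichlet_NormedModuleAux.
Proof.
  apply (NormedModule.Mixin C_AbsRing dirichlet_NormedModuleAux dnorm 1).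
  - exact dnorm_triangle.
  - intros l f. apply Req_le. exact (dnorm_scal l f).
  - intros f g eps H. exact H.
  - intros f g eps H. rewrite Rmult_1_l. exact H.
  - exact dnorm_eq_0.
Defined.

Canonical dirichlet_NormedModule :=
  NormedModule.Pack C_AbsRing (dirichlet nu)
    (NormedModule.Class _ _ _ dirichlet_NormedModule_mixin) (dirichlet nu).

End NormedSpace.

Definition recurrent {K : AbsRing} {X : NormedModule K} (T : X -> X) : Prop :=
  forall U : X -> Prop, open U -> (exists x : X, U x) ->
    exists k : nat, (0 < k)%nat /\ exists x : X, U x /\ U (Nat.iter k T x).

(* By [dirichlet_ext] there is at most one such [T].  That there is one, i.e. that
   composition with [phi] maps [dirichlet nu] into itself, is a classical fact. *)
Definition is_composition_operator (nu : R) (phi : lft)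
  (Hphi : self_map_of_disk phi) (T : dirichlet nu -> dirichlet nu) : Prop :=
  forall (f : dirichlet nu) (z : disk), T f z = f (disk_map phi Hphi z).

(* Main.v *)
From Stdlib Require Import Reals Lra Lia.
Require Import Defs.

(** Why the theorem holds.  In the coordinate [v = 1 / (1 - z / zeta)], where [zeta]
    is the fixed point, [phi] is a translation [v |-> v + t] of the half-plane
    [Re v > 1 / 2], and [Re t > 0] because [phi] is not an automorphism
    ([parabolic_nonautomorphism_translation]).  Translating far into the half-plane
    makes a function of polynomial growth look like a polynomial of bounded degree:
    sufficiently high differences with step [t] tend to [0].  So let [ell f] be the
    [(p+2)]-nd difference at index [0] of the values of [f] along the orbit of the
    origin, with a natural number [p >= - nu].  On iterates, [ell (T ^ n f)] is the
    same difference taken at index [n], and it is at most a constant times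
    [||f|| / (n + 1)] ([fdiff_orbit_le]).

    A vector [g] near the identity function [f0] satisfies
    [ell g] near [ell f0 <> 0] ([fdiff_disk_pt_neq_0]), whereas [ell (T ^ n g)] is
    small for all large [n]; so [T ^ n g] cannot be near [f0] again for large [n].
    The finitely many remaining [n > 0] are excluded by shrinking the neighbourhood,
    because [f0] takes different values at the origin and at its image under the
    [n]-th iterate of [phi] ([not_recurrent_of_vanishing_functional]).

    The analytic input is the bound on differences of the monomials [z ^ i] along the
    orbit, uniform in [i] ([fdiff_disk_pt_pow_le]).  Cauchy's estimate on disks of
    radius proportional to [n] in the half-plane would give it; here it follows from
    an elementary recursion in [i]. *)

(** * Finite differences along the orbit *)

Fixpoint fdiff (k : nat) (x : nat -> C) (n : nat) : C :=
  match k with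
  | O => x n
  | S k => (fdiff k x (S n) - fdiff k x n)%C
  end.

Lemma fdiff_ext (k : nat) (x y : nat -> C) (n : nat) :
  (forall m, x m = y m) -> fdiff k x n = fdiff k y n.
Proof.
  intros H; revert n; induction k as [|k IH]; intros n; simpl.
  - apply H.
  - now rewrite !IH.
Qed.

Lemma fdiff_minus (k : nat) (x y : nat -> C) (n : nat) :
  fdiff k (fun m => (x m - y m)%C) n = (fdiff k x n - fdiff k y n)%C.
Proof.
  revert n; induction k as [|k IH]; intros n; simpl.
  - reflexivity.
  - rewrite !IH; ring.
Qed.

Lemma fdiff_scal (k : nat) (l : C) (x : nat -> C) (n : nat) :
  fdiff k (fun m => (l * x m)%C) n = (l * fdiff k x n)%C.
Proof.
  revert n; induction k as [|k IH]; intros n; simpl.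
  - reflexivity.
  - rewrite !IH; ring.
Qed.

Lemma fdiff_shift (k : nat) (x : nat -> C) (n : nat) :
  fdiff k (fun m => x (n + m)%nat) 0 = fdiff k x n.
Proof.
  assert (H : forall j, fdiff k (fun m => x (n + m)%nat) j = fdiff k x (n + j)%nat).
  { induction k as [|k IH]; intros j; simpl.
    - reflexivity.
    - now rewrite !IH, Nat.add_succ_r. }
  now rewrite H, Nat.add_0_r.
Qed.

Lemma fdiff_const (k : nat) (l : C) (n : nat) :
  fdiff (S k) (fun _ => l) n = RtoC 0.
Proof.
  revert n; induction k as [|k IH]; intros n.
  - simpl; ring.
  - change (fdiff (S k) (fun _ => l) (S n) - fdiff (S k) (fun _ => l) n = 0)%C.
    rewrite !IH; ring.
Qed.

(** The orbit of [0] in the coordinate [1 / (1 - z / zeta)], which carries the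
    disk onto the half-plane [Re v > 1 / 2] and turns a parabolic map with fixed
    point [zeta] into the translation by [t].  The origin has coordinate [1]. *)
Definition half_plane_pt (t : C) (m : nat) : C := (1 + INR m * t)%C.

(** Back in the disk, up to the unimodular factor [zeta]. *)
Definition disk_pt (t : C) (m : nat) : C := (1 - / half_plane_pt t m)%C.

Lemma half_plane_pt_neq_0 (t : C) (m : nat) : 0 < Re t -> half_plane_pt t m <> RtoC 0.
Proof.
  intros Ht E. assert (E1 : Re (half_plane_pt t m) = 0) by now rewrite E.
  unfold half_plane_pt, Re in *; simpl in *.
  assert (0 <= INR m * fst t) by (apply Rmult_le_pos; [apply pos_INR | lra]).
  lra.
Qed.

(** Leibniz's rule for a factor that is affine in the index, whose second
    difference vanishes: only two terms survive. *)
Lemma fdiff_affine_mult (t : C) (y : nat -> C) (k n : nat) :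
  fdiff (S k) (fun m => (half_plane_pt t m * y m)%C) n
  = (half_plane_pt t (n + S k) * fdiff (S k) y n + INR (S k) * t * fdiff k y n)%C.
Proof.
  revert n; induction k as [|k IH]; intros n.
  - simpl fdiff. rewrite Nat.add_1_r. unfold half_plane_pt.
    rewrite S_INR, RtoC_plus. simpl INR. ring.
  - change (fdiff (S (S k)) (fun m => (half_plane_pt t m * y m)%C) n) with
      (fdiff (S k) (fun m => (half_plane_pt t m * y m)%C) (S n)
       - fdiff (S k) (fun m => (half_plane_pt t m * y m)%C) n)%C.
    rewrite !IH.
    change (fdiff (S (S k)) y n) with (fdiff (S k) y (S n) - fdiff (S k) y n)%C.
    change (fdiff (S k) y n) with (fdiff k y (S n) - fdiff k y n)%C.
    unfold half_plane_pt. rewrite !plus_INR, !S_INR, !RtoC_plus. ring.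
Qed.

(** Differencing [v * (1 / v) = 1] relates consecutive differences of [1 / v] by a
    nonzero factor, so none of them vanishes. *)
Lemma fdiff_disk_pt_neq_0 (t : C) (k n : nat) :
  t <> RtoC 0 -> (forall m, half_plane_pt t m <> RtoC 0) ->
  fdiff (S k) (disk_pt t) n <> RtoC 0.
Proof.
  intros Ht Hv.
  assert (Hinv : forall j, fdiff j (fun m => / half_plane_pt t m)%C n <> RtoC 0).
  { induction j as [|j IH].
    - simpl. intros E. apply C1_nz. rewrite <- (Cinv_r (half_plane_pt t n)) by apply Hv.
      rewrite E; ring.
    - intros E.
      assert (H := fdiff_affine_mult t (fun m => / half_plane_pt t m)%C j n).
      rewrite (fdiff_ext _ _ (fun _ => RtoC 1)), fdiff_const, E in H
        by (intros m; apply Cinv_r, Hv).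
      assert (HS : RtoC (INR (S j)) <> RtoC 0).
      { intros F. apply RtoC_inj in F. now apply (not_0_INR (S j)). }
      apply (Cmult_neq_0 _ _ (Cmult_neq_0 _ _ HS Ht) IH).
      rewrite H; ring. }
  unfold disk_pt. rewrite fdiff_minus, fdiff_const.
  intros E. apply (Hinv (S k)).
  replace (fdiff (S k) (fun m => / half_plane_pt t m)%C n)
    with (- (0 - fdiff (S k) (fun m => / half_plane_pt t m)%C n))%C by ring.
  rewrite E; ring.
Qed.

(** The main estimate: in [k]-th differences, powers of the orbit gain [dl ^ k]
    with a constant that does not depend on the exponent [i], although
    differentiating an [i]-th power would naively cost a factor [i ^ k].  Write
    [x = 1 - 1 / v], [Y i] for the [k+1]-st difference of [x ^ i] and [D j i] for
    the [j]-th difference of [x ^ i / v = x ^ i - x ^ (i+1)].  Applying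
    [fdiff_affine_mult] to [v * (x ^ i / v) = x ^ i] gives
    [Y (i+1) = x * Y i + (1 / v) * (k+1) * t * D k i], a recursion in [i] with a
    fixed base index.  Its forcing term has size [dl ^ (k+2) * q ^ i], one power of
    [dl] better than the claim, and the gap [c * dl] between [|x|] and [q] absorbs
    it.  The two bounds are proved together because the one for [D] feeds the next
    order.  In use [dl = 1 / (n + 1)], and the hypotheses concern a window of fixed
    length [K] because [|x|] tends to [1] along the whole orbit. *)
Lemma fdiff_disk_pt_pow_le (t : C) (C0 c : R) (K : nat) :
  0 <= C0 -> 0 < c -> (forall m, half_plane_pt t m <> RtoC 0) ->
  forall k, (k <= K)%nat -> exists A B : R, 0 <= A /\ 0 <= B /\
  forall (n : nat) (dl q : R), 0 <= dl ->
    (forall j, (j <= K)%nat -> Cmod (/ half_plane_pt t (n + j)) <= C0 * dl) ->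
    (forall j, (j <= K)%nat -> Cmod (disk_pt t (n + j)) + c * dl <= q) ->
    forall i : nat,
      Cmod (fdiff k (fun m => disk_pt t m ^ i)%C n) <= A * dl ^ k * q ^ i /\
      Cmod (fdiff k (fun m => disk_pt t m ^ i / half_plane_pt t m)%C n)
        <= B * dl ^ S k * q ^ i.
Proof.
  intros HC0 Hc Hv.
  induction k as [|k IH]; intros Hk.
  - exists 1, C0. split; [lra|]. split; [exact HC0|].
    intros n dl q Hdl Hu Hx i; simpl fdiff.
    specialize (Hu 0%nat Hk); specialize (Hx 0%nat Hk).
    rewrite Nat.add_0_r in Hu, Hx.
    assert (H0 := Cmod_ge_0 (disk_pt t n)).
    assert (Hcd : 0 <= c * dl) by (apply Rmult_le_pos; lra).
    assert (Hp : Cmod (disk_pt t n ^ i) <= q ^ i).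
    { rewrite Cmod_pow. apply pow_incr; lra. }
    split; [simpl pow at 1; lra|].
    unfold Cdiv; rewrite Cmod_mult.
    rewrite pow_1, (Rmult_comm _ (q ^ i)).
    apply Rmult_le_compat; auto using Cmod_ge_0.
  - destruct IH as [A [B [HA [HB IH]]]]; [lia|].
    assert (Ht := Cmod_ge_0 t).
    assert (HS := pos_INR (S k)).
    set (s := INR (S k) * Cmod t) in *.
    assert (Hs : 0 <= s) by (apply Rmult_le_pos; assumption).
    set (A' := C0 * s * B / c).
    assert (HA' : 0 <= A').
    { unfold A'. apply Rdiv_le_0_compat; [|exact Hc]. repeat apply Rmult_le_pos; auto. }
    assert (EA' : A' * c = C0 * s * B) by (unfold A'; field; lra).
    clearbody A'.
    exists A', (C0 * (A' + s * B)).
    split; [exact HA'|]. split.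
    { apply Rmult_le_pos; [exact HC0|]. apply Rplus_le_le_0_compat; [exact HA'|].
      apply Rmult_le_pos; auto. }
    intros n dl q Hdl Hu Hx.
    specialize (IH n dl q Hdl Hu Hx).
    specialize (Hu (S k) Hk); specialize (Hx (S k) Hk).
    set (w := half_plane_pt t (n + S k)) in *.
    assert (Hw : w <> RtoC 0) by apply Hv.
    set (Y := fun i => fdiff (S k) (fun m => disk_pt t m ^ i)%C n).
    set (D := fun j i => fdiff j (fun m => disk_pt t m ^ i / half_plane_pt t m)%C n).
    change (forall i, Cmod (Y i) <= A' * dl ^ S k * q ^ i /\
                      Cmod (D (S k) i) <= C0 * (A' + s * B) * dl ^ S (S k) * q ^ i).
    assert (HD : forall i, D (S k) i = (/ w * (Y i - INR (S k) * t * D k i))%C).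
    { intros i.
      assert (E : Y i = (w * D (S k) i + INR (S k) * t * D k i)%C).
      { unfold Y, D, w. rewrite <- fdiff_affine_mult. apply fdiff_ext; intros m.
        field. apply Hv. }
      rewrite E; field; exact Hw. }
    assert (HYS : forall i, Y (S i)
      = (disk_pt t (n + S k) * Y i + / w * (INR (S k) * t * D k i))%C).
    { intros i.
      assert (E : Y (S i) = (Y i - D (S k) i)%C).
      { unfold Y, D. rewrite <- fdiff_minus. apply fdiff_ext; intros m.
        rewrite Cpow_S. unfold disk_pt. field. apply Hv. }
      rewrite E, HD. unfold disk_pt; fold w. field; exact Hw. }
    assert (H0 := Cmod_ge_0 (disk_pt t (n + S k))).
    assert (Hcd : 0 <= c * dl) by (apply Rmult_le_pos; lra).
    assert (Hqi : forall i, 0 <= q ^ i) by (intros i; apply pow_le; lra).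
    assert (Hdk : forall j, 0 <= dl ^ j) by (intros j; apply pow_le; lra).
    assert (Hdrop : forall i, Cmod (INR (S k) * t * D k i)
                              <= s * B * dl ^ S k * q ^ i).
    { intros i. rewrite !Cmod_mult, Cmod_R, (Rabs_pos_eq _ HS). fold s.
      rewrite !(Rmult_assoc s). apply Rmult_le_compat_l; [exact Hs|].
      apply IH. }
    assert (HY : forall i, Cmod (Y i) <= A' * dl ^ S k * q ^ i).
    { induction i as [|i IHi].
      - unfold Y. rewrite (fdiff_ext _ _ (fun _ => RtoC 1)), fdiff_const, Cmod_0
          by reflexivity.
        repeat apply Rmult_le_pos; auto.
      - rewrite HYS.
        eapply Rle_trans; [apply Cmod_triangle|].
        rewrite (Cmod_mult (disk_pt _ _)), (Cmod_mult (/ w)).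
        apply Rle_trans with ((q - c * dl) * (A' * dl ^ S k * q ^ i)
                              + (C0 * dl) * (s * B * dl ^ S k * q ^ i)).
        + apply Rplus_le_compat; apply Rmult_le_compat;
            auto using Cmod_ge_0; lra.
        + apply Req_le.
          transitivity (A' * dl ^ S k * q ^ S i
                        + dl * dl ^ S k * q ^ i * (C0 * s * B - A' * c)).
          * simpl; ring.
          * rewrite EA'; ring. }
    intros i; split; [apply HY|].
    rewrite HD, Cmod_mult.
    apply Rle_trans with
      ((C0 * dl) * (A' * dl ^ S k * q ^ i + s * B * dl ^ S k * q ^ i)).
    + apply Rmult_le_compat; auto using Cmod_ge_0.
      unfold Cminus. eapply Rle_trans; [apply Cmod_triangle|].
      rewrite Cmod_opp. apply Rplus_le_compat; auto.
    + apply Req_le; simpl; ring.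
Qed.

(** The exact defect of [|1 - 1 / v|] from [1]: it shows that [v |-> 1 - 1 / v] maps
    [Re v > 1 / 2] into the unit disk, and it measures the distance to the circle. *)
Lemma Cmod_1_minus_inv (v : C) : v <> RtoC 0 ->
  Cmod (1 - / v) ^ 2 = 1 - (2 * Re v - 1) / Cmod v ^ 2.
Proof.
  intros Hv.
  assert (Hm : 0 < Cmod v) by (apply Cmod_gt_0, Hv).
  assert (Hm2 : Cmod v ^ 2 <> 0) by (apply pow_nonzero; lra).
  apply Rmult_eq_reg_r with (Cmod v ^ 2); [|exact Hm2].
  rewrite <- Rpow_mult_distr, <- Cmod_mult.
  replace ((1 - / v) * v)%C with (v - 1)%C by (field; exact Hv).
  rewrite Rmult_minus_distr_r; unfold Rdiv at 1; rewrite Rmult_assoc, Rinv_l by exact Hm2.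
  rewrite !Cmod2_alt. unfold Re, Im; simpl. ring.
Qed.

(** Since [Re t > 0], the orbit tends to the fixed point non-tangentially: both
    [|v|] and [Re v] grow linearly, so the distance to the fixed point and the
    distance to the unit circle are comparable to [1 / (n + 1)].  This is where
    automorphisms, for which [Re t = 0], escape. *)
Lemma disk_pt_bounds (t : C) (K : nat) : 0 < Re t ->
  exists C0 c : R, 0 <= C0 /\ 0 < c /\
  forall n j, (j <= K)%nat ->
    Cmod (/ half_plane_pt t (n + j)) <= C0 * / INR (S n) /\
    Cmod (disk_pt t (n + j)) <= 1 - 2 * c * / INR (S n).
Proof.
  intros Ht.
  set (k := Rmin 1 (Re t)).
  assert (Hk : 0 < k) by (apply Rmin_glb_lt; lra).
  assert (Hk1 : k <= 1) by apply Rmin_l.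
  assert (Hkt : k <= Re t) by apply Rmin_r.
  set (B := 1 + INR (S K) * Cmod t).
  assert (HT := Cmod_ge_0 t).
  assert (HB : 1 <= B).
  { unfold B. assert (0 <= INR (S K) * Cmod t) by (apply Rmult_le_pos; auto using pos_INR).
    lra. }
  exists (/ k), (k / (4 * B ^ 2)).
  assert (HB2 : 0 < B ^ 2) by (apply pow_lt; lra).
  split; [apply Rlt_le, Rinv_0_lt_compat, Hk|].
  split; [apply Rdiv_lt_0_compat; lra|].
  intros n j Hj.
  assert (Hn := pos_INR n).
  assert (Hj0 := pos_INR j).
  assert (HjK : INR j <= INR K) by now apply le_INR.
  assert (HN : 1 <= INR (S n)) by (rewrite S_INR; lra).
  assert (Hre : Re (half_plane_pt t (n + j)) = 1 + (INR n + INR j) * Re t).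
  { unfold half_plane_pt, Re. rewrite plus_INR. simpl. ring. }
  assert (Hlo : k * INR (S n) <= Re (half_plane_pt t (n + j))).
  { rewrite Hre, S_INR.
    assert (INR n * k <= INR n * Re t) by (apply Rmult_le_compat_l; lra).
    assert (0 <= INR j * Re t) by (apply Rmult_le_pos; lra). lra. }
  assert (Hlo2 : k * INR (S n) <= 2 * Re (half_plane_pt t (n + j)) - 1).
  { rewrite Hre, S_INR.
    assert (INR n * k <= INR n * Re t) by (apply Rmult_le_compat_l; lra).
    assert (0 <= INR j * Re t) by (apply Rmult_le_pos; lra).
    assert (0 <= INR n * Re t) by (apply Rmult_le_pos; lra). lra. }
  assert (Hpos : 0 < k * INR (S n)) by (apply Rmult_lt_0_compat; lra).
  assert (Hmod : k * INR (S n) <= Cmod (half_plane_pt t (n + j))).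
  { assert (H := re_le_Cmod (half_plane_pt t (n + j))).
    assert (H' := Rle_abs (Re (half_plane_pt t (n + j)))).
    lra. }
  assert (Hnz : half_plane_pt t (n + j) <> RtoC 0) by (apply Cmod_gt_0; lra).
  assert (Hup : Cmod (half_plane_pt t (n + j)) <= B * INR (S n)).
  { unfold half_plane_pt, B. eapply Rle_trans; [apply Cmod_triangle|].
    rewrite Cmod_1, Cmod_mult, Cmod_R, (Rabs_pos_eq _ (pos_INR _)).
    rewrite plus_INR, !S_INR.
    assert (INR j * Cmod t <= INR K * Cmod t) by (apply Rmult_le_compat_r; lra).
    assert (0 <= INR n * (INR K * Cmod t)) by
      (repeat apply Rmult_le_pos; auto using pos_INR). lra. }
  split.
  - rewrite Cmod_inv, <- Rinv_mult by exact Hnz.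
    apply Rinv_le_contravar; assumption.
  - set (d := / INR (S n)).
    assert (Hd : 0 < d) by (apply Rinv_0_lt_compat; lra).
    assert (HdN : d * INR (S n) = 1) by (unfold d; field; lra).
    set (e := k * d / B ^ 2).
    replace (1 - 2 * (k / (4 * B ^ 2)) * d) with (1 - e / 2)
      by (unfold e; field; lra).
    assert (Hd1 : d <= 1) by (unfold d; rewrite <- Rinv_1; apply Rinv_le_contravar; lra).
    assert (He : e <= 1).
    { unfold e. apply Rle_div_l; [exact HB2|].
      assert (k * d <= 1 * 1) by (apply Rmult_le_compat; lra).
      assert (1 ^ 2 <= B ^ 2) by (apply pow_incr; lra). lra. }
    assert (Hsq : Cmod (disk_pt t (n + j)) ^ 2 <= 1 - e).
    { unfold disk_pt. rewrite Cmod_1_minus_inv by exact Hnz.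
      apply Rplus_le_compat_l, Ropp_le_contravar.
      replace e with (k * INR (S n) / (B * INR (S n)) ^ 2).
      2:{ unfold e, d. field. lra. }
      apply Rmult_le_compat; [lra | | exact Hlo2 |].
      - apply Rlt_le, Rinv_0_lt_compat, pow_lt. apply Rmult_lt_0_compat; lra.
      - apply Rinv_le_contravar; [apply pow_lt; lra|].
        apply pow_incr; lra. }
    apply Rsqr_incr_0; [|apply Cmod_ge_0|lra].
    unfold Rsqr. assert (0 <= e * e) by apply Rle_0_sqr. simpl in Hsq. lra.
Qed.

(** * Differences of the values of a Dirichlet function *)

Lemma is_series_C_Cmod_le (b : nat -> C) (r : nat -> R) (l : C) (s : R) :
  @is_series C_AbsRing C_NormedModule b l -> is_series r s ->
  (forall i, Cmod (b i) <= r i) -> Cmod l <= s.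
Proof.
  intros Hb Hr Hle.
  assert (Hsum : forall m, Cmod (sum_n b m) <= sum_n r m).
  { induction m as [|m IH].
    - rewrite !sum_O; apply Hle.
    - rewrite !sum_Sn. eapply Rle_trans; [apply Cmod_triangle|].
      apply Rplus_le_compat; [exact IH | apply Hle]. }
  apply (filterlim_le (F := eventually) (fun m => Cmod (sum_n b m)) (sum_n r)
           (Cmod l) s).
  - exists 0%nat; intros m _; apply Hsum.
  - change (filterlim (fun m => Cmod (sum_n b m)) eventually (locally (Cmod l))).
    eapply filterlim_comp; [exact Hb|].
    exact (@filterlim_norm C_AbsRing C_NormedModule l).
  - exact Hr.
Qed.

Lemma wterm_le_Series (nu : R) (a : nat -> C) (n : nat) :
  ex_series (wterm nu a) -> wterm nu a n <= Series (wterm nu a).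
Proof.
  intros Ha.
  assert (Hinc : forall m, sum_n (wterm nu a) m <= sum_n (wterm nu a) (S m)).
  { intros m. rewrite sum_Sn. unfold plus; simpl.
    assert (H := wterm_ge_0 nu a (S m)); lra. }
  apply Rle_trans with (sum_n (wterm nu a) n).
  - destruct n as [|n]; [rewrite sum_O; lra|].
    rewrite sum_Sn. unfold plus; simpl.
    assert (H : 0 <= sum_n (wterm nu a) n).
    { induction n as [|n IH].
      - rewrite sum_O; apply wterm_ge_0.
      - apply Rle_trans with (1 := IH), Hinc. }
    lra.
  - exact (is_lim_seq_incr_compare _ _ (Series_correct _ Ha) Hinc n).
Qed.

(** The only link between the norm and the values of [f] that the estimates need:
    coefficients grow at most like a fixed power of the index. *)
Lemma dcoef_le (nu : R) (p : nat) (f : dirichlet nu) (i : nat) :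
  - nu <= INR p -> Cmod (dcoef f i) <= dnorm f * INR (S i) ^ p.
Proof.
  intros Hp.
  assert (H := wterm_le_Series nu (dcoef f) i (dcoef_summable f)).
  rewrite <- dnorm_sqr in H. unfold wterm in H.
  assert (Hw := weight_pos nu i).
  assert (Hi : 1 <= INR (S i)) by (rewrite S_INR; assert (H0 := pos_INR i); lra).
  assert (Hwp : 1 <= weight nu i * (INR (S i) ^ p) ^ 2).
  { rewrite <- pow_mult, <- Rpower_pow by lra.
    unfold weight. rewrite Nat.add_1_r, <- Rpower_plus.
    rewrite <- (Rpower_O (INR (S i))) at 1 by lra.
    apply Rle_Rpower; [exact Hi|]. rewrite mult_INR; simpl INR; lra. }
  assert (HP : 0 <= INR (S i) ^ p) by (apply pow_le; lra).
  apply Rsqr_incr_0; [|apply Cmod_ge_0|apply Rmult_le_pos; auto using dnorm_ge_0].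
  rewrite !Rsqr_pow2, Rpow_mult_distr.
  assert (Hc := pow2_ge_0 (Cmod (dcoef f i))).
  assert (HP2 := pow2_ge_0 (INR (S i) ^ p)).
  apply Rle_trans with (Cmod (dcoef f i) ^ 2 * (weight nu i * (INR (S i) ^ p) ^ 2)).
  - rewrite <- (Rmult_1_r (_ ^ 2)) at 1. now apply Rmult_le_compat_l.
  - rewrite <- Rmult_assoc. now apply Rmult_le_compat_r.
Qed.

Lemma pow_inv_1_plus_ge (eta : R) (k : nat) :
  0 < eta -> 1 - INR k * eta <= (/ (1 + eta)) ^ k.
Proof.
  intros He. set (s := / (1 + eta)).
  assert (Hs : s * (1 + eta) = 1) by (unfold s; field; lra).
  assert (Hs0 : 0 < s) by (apply Rinv_0_lt_compat; lra).
  assert (Hse : 0 < s * eta) by (apply Rmult_lt_0_compat; lra).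
  assert (Hp : forall j, 0 <= s ^ j <= 1).
  { intros j; split; [apply pow_le; lra|].
    rewrite <- (pow1 j). apply pow_incr; lra. }
  induction k as [|k IH]; [simpl; lra|].
  rewrite S_INR.
  replace (s ^ S k) with (s ^ k - eta * s ^ S k)
    by (simpl; replace (s ^ k) with (s ^ k * (s * (1 + eta))) at 1
          by (rewrite Hs; ring); ring).
  assert (eta * s ^ S k <= eta * 1) by (apply Rmult_le_compat_l; [lra|apply Hp]).
  lra.
Qed.

(** The polynomial weight is paid for with [p] of the [p+1] geometric factors,
    through Bernoulli's inequality [(i+1) * eta <= (1 + eta) ^ (i+1)]. *)
Lemma pow_mul_geom_le (eta : R) (p i : nat) : 0 < eta ->
  INR (S i) ^ p * ((/ (1 + eta)) ^ S p) ^ i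
  <= ((1 + eta) / eta) ^ p * (/ (1 + eta)) ^ i.
Proof.
  intros He. set (s := / (1 + eta)).
  assert (Hs0 : 0 < s) by (apply Rinv_0_lt_compat; lra).
  assert (Hs : (1 + eta) * s = 1) by (unfold s; field; lra).
  assert (H : INR (S i) <= (1 + eta) / eta * (1 + eta) ^ i).
  { replace ((1 + eta) / eta * (1 + eta) ^ i) with ((1 + eta) ^ S i / eta)
      by (simpl; field; lra).
    apply Rle_div_r; [lra|].
    assert (H := poly (S i) eta He). lra. }
  assert (H0 := pos_INR (S i)).
  apply Rle_trans with (((1 + eta) / eta * (1 + eta) ^ i) ^ p * (s ^ S p) ^ i).
  - apply Rmult_le_compat_r; [apply pow_le, pow_le; lra|].
    apply pow_incr; lra.
  - apply Req_le.
    rewrite Rpow_mult_distr, <- !pow_mult.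
    replace (S p * i)%nat with (i * p + i)%nat by lia.
    rewrite pow_add, Rmult_assoc. f_equal.
    rewrite <- Rmult_assoc, <- Rpow_mult_distr, Hs, pow1. ring.
Qed.

Lemma is_series_fdiff (a : nat -> C) (z F : nat -> C) (k n : nat) :
  (forall m, @is_pseries C_AbsRing C_NormedModule a (z m) (F m)) ->
  @is_series C_AbsRing C_NormedModule
    (fun i => (a i * fdiff k (fun m => z m ^ i) n)%C) (fdiff k F n).
Proof.
  intros H; revert n; induction k as [|k IH]; intros n; simpl.
  - specialize (H n). unfold is_pseries in H.
    refine (is_series_ext _ _ _ _ H).
    intros i.
    assert (E : pow_n (z n : C_AbsRing) i = (z n ^ i)%C).
    { induction i as [|i IHi]; [reflexivity|].
      rewrite Cpow_S, <- IHi; reflexivity. }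
    rewrite E. apply Cmult_comm.
  - refine (is_series_ext _ _ _ _ (is_series_minus _ _ _ _ (IH (S n)) (IH n))).
    intros i. simpl. unfold minus, plus, opp; simpl. ring.
Qed.

(** The norm of the functional taking [f] to the [k]-th difference of its values
    along the orbit.  Summing [fdiff_disk_pt_pow_le] against coefficients of size
    [(i+1) ^ p] costs [(n+1) ^ (p+1)], and each difference gains a factor
    [1 / (n+1)]; hence it tends to [0] as soon as [k > p + 1]. *)
Lemma fdiff_orbit_le (nu : R) (p : nat) (t zeta : C) (k : nat) :
  - nu <= INR p -> 0 < Re t -> Cmod zeta = 1 ->
  exists A : R, 0 <= A /\ forall (f : dirichlet nu) (F : nat -> C) (n : nat),
    (forall m, @is_pseries C_AbsRing C_NormedModule
                 (dcoef f) (zeta * disk_pt t m)%C (F m)) ->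
    Cmod (fdiff k F n) <= A * dnorm f * INR (S n) ^ S p * (/ INR (S n)) ^ k.
Proof.
  intros Hp Ht Hz.
  assert (Hv : forall m, half_plane_pt t m <> RtoC 0)
    by (intros m; apply half_plane_pt_neq_0, Ht).
  destruct (disk_pt_bounds t k Ht) as [C0 [c [HC0 [Hc Hb]]]].
  destruct (fdiff_disk_pt_pow_le t C0 c k HC0 Hc Hv k (le_n k))
    as [A [B [HA [_ HAB]]]].
  (* With [eta = e / (n+1)], the ratio [q = (1 + eta) ^ - (p+1)] is at least
     [1 - c / (n+1)], so it exceeds [|x| <= 1 - 2 * c / (n+1)] by [c / (n+1)]. *)
  set (e := c / INR (S p)).
  assert (HSp : 0 < INR (S p)) by (apply lt_0_INR; lia).
  assert (He : 0 < e) by (apply Rdiv_lt_0_compat; assumption).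
  exists (A * (1 + / e) ^ S p).
  assert (Hie : 0 < / e) by now apply Rinv_0_lt_compat.
  split; [apply Rmult_le_pos; [exact HA | apply pow_le; lra]|].
  intros f F n HF.
  set (N := INR (S n)).
  assert (HN : 1 <= N) by (unfold N; rewrite S_INR; assert (H0 := pos_INR n); lra).
  assert (Hd : 0 < / N) by (apply Rinv_0_lt_compat; lra).
  set (eta := e * / N).
  assert (Heta : 0 < eta) by (apply Rmult_lt_0_compat; assumption).
  set (s := / (1 + eta)).
  assert (Hs : 0 < s < 1).
  { unfold s; split; [apply Rinv_0_lt_compat; lra|].
    apply Rlt_le_trans with (/ 1); [apply Rinv_lt_contravar; lra|].
    rewrite Rinv_1; lra. }
  assert (Hq := pow_inv_1_plus_ge eta (S p) Heta). fold s in Hq.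
  set (q := s ^ S p) in *.
  assert (Hbd : forall i, Cmod (fdiff k (fun m => (zeta * disk_pt t m) ^ i)%C n)
                          <= A * (/ N) ^ k * q ^ i).
  { intros i.
    rewrite (fdiff_ext _ _ (fun m => (zeta ^ i * disk_pt t m ^ i)%C))
      by (intros m; apply Cpow_mult_l).
    rewrite fdiff_scal, Cmod_mult, Cmod_pow, Hz, pow1, Rmult_1_l.
    apply HAB; [lra | |].
    - intros j Hj. apply Hb, Hj.
    - intros j Hj. apply Rle_trans with (2 := Hq).
      destruct (Hb n j Hj) as [_ H]. fold N in H.
      replace (INR (S p) * eta) with (c * / N) by (unfold eta, e; field; lra).
      lra. }
  set (M := ((1 + eta) / eta) ^ p).
  assert (HM : 0 <= M).
  { apply pow_le, Rlt_le, Rdiv_lt_0_compat; lra. }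
  assert (Hdn := dnorm_ge_0 nu f).
  apply Rle_trans with (dnorm f * (A * (/ N) ^ k) * M * / (1 - s)).
  - refine (is_series_C_Cmod_le _
      (fun i => dnorm f * (A * (/ N) ^ k) * M * s ^ i) _ _
      (is_series_fdiff _ _ _ k n HF) _ _).
    + refine (is_series_scal (K := R_AbsRing) (V := R_NormedModule) _ _ _
                (is_series_geom s _)).
      rewrite Rabs_pos_eq; lra.
    + intros i. rewrite Cmod_mult.
      assert (Hg := pow_mul_geom_le eta p i Heta). fold s q M in Hg.
      apply Rle_trans with ((dnorm f * INR (S i) ^ p) * (A * (/ N) ^ k * q ^ i)).
      * apply Rmult_le_compat; auto using Cmod_ge_0, dcoef_le.
      * replace (dnorm f * INR (S i) ^ p * (A * (/ N) ^ k * q ^ i))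
          with (dnorm f * (A * (/ N) ^ k) * (INR (S i) ^ p * q ^ i)) by ring.
        rewrite (Rmult_assoc _ M).
        apply Rmult_le_compat_l; [|exact Hg].
        apply Rmult_le_pos; [exact Hdn|]. apply Rmult_le_pos; [exact HA|].
        apply pow_le; lra.
  - replace (/ (1 - s)) with ((1 + eta) / eta) by (unfold s; field; lra).
    replace (dnorm f * (A * (/ N) ^ k) * M * ((1 + eta) / eta))
      with (dnorm f * (A * (/ N) ^ k) * ((1 + eta) / eta) ^ S p)
      by (unfold M; simpl; ring).
    replace (A * (1 + / e) ^ S p * dnorm f * N ^ S p * (/ N) ^ k)
      with (dnorm f * (A * (/ N) ^ k) * ((1 + / e) * N) ^ S p)
      by (rewrite Rpow_mult_distr; ring).
    apply Rmult_le_compat_l.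
    { apply Rmult_le_pos; [exact Hdn|]. apply Rmult_le_pos; [exact HA|].
      apply pow_le; lra. }
    apply pow_incr; split; [apply Rlt_le, Rdiv_lt_0_compat; lra|].
    replace ((1 + eta) / eta) with (1 + / e * N) by (unfold eta; field; lra).
    lra.
Qed.

(** * Parabolic maps as translations of a half-plane *)

Lemma Re_neq_0 (v : C) : 0 < Re v -> v <> RtoC 0.
Proof. intros H E. rewrite E in H. simpl in H. lra. Qed.

Lemma Cmod_1_minus_inv_lt_1 (v : C) : v <> RtoC 0 ->
  Cmod (1 - / v) < 1 <-> 1 / 2 < Re v.
Proof.
  intros Hv.
  assert (H := Cmod_1_minus_inv v Hv).
  assert (Hm : 0 < Cmod v ^ 2) by (apply pow_lt, Cmod_gt_0, Hv).
  assert (H0 := Cmod_ge_0 (1 - / v)).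
  set (m := Cmod (1 - / v)) in *.
  split; intros Hlt.
  - assert (Hp : 0 < (2 * Re v - 1) / Cmod v ^ 2).
    { assert (0 < (1 - m) * (1 + m)) by (apply Rmult_lt_0_compat; lra). simpl in *; lra. }
    apply Rlt_div_r in Hp; [lra | exact Hm].
  - assert (Hp : 0 < (2 * Re v - 1) / Cmod v ^ 2) by (apply Rdiv_lt_0_compat; lra).
    destruct (Rlt_le_dec m 1) as [Hl|Hl]; [exact Hl|exfalso].
    assert (1 ^ 2 <= m ^ 2) by (apply pow_incr; lra). lra.
Qed.

(** The fixed points are the roots of a quadratic; [c <> 0] since infinity is not
    fixed, and the second root [(a - d) / c - zeta] must coincide with [zeta].  This
    determines [a] and [b] from [c], [d] and [zeta], and the conjugate of [phi]
    becomes [v |-> v - c * zeta / (c * zeta + d)]. *)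
Lemma parabolic_translation (phi : lft) :
  self_map_of_disk phi -> parabolic phi ->
  exists zeta t : C, Cmod zeta = 1 /\
    forall v : C, 1 / 2 < Re v ->
      (v + t)%C <> RtoC 0 /\
      lft_eval phi (zeta * (1 - / v))%C = (zeta * (1 - / (v + t)))%C.
Proof.
  intros Hphi [zeta [Hz Hfix]].
  assert (Hz0 : zeta <> RtoC 0) by (apply Cmod_gt_0; lra).
  destruct phi as [a b c d Hdet].
  assert (Hc : c <> RtoC 0).
  { intros E. assert (HN := proj1 (Hfix None)). simpl in HN.
    destruct (Ceq_dec c 0); [specialize (HN eq_refl); discriminate | contradiction]. }
  assert (Hf := proj2 (Hfix (Some zeta)) eq_refl).
  simpl in Hf. unfold lft_eval, lft_num, lft_den in Hf; simpl in Hf.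
  destruct (Ceq_dec (c * zeta + d) 0) as [|Hden]; [discriminate|].
  injection Hf; clear Hf; intros Hf.
  assert (Hq : (a * zeta + b = zeta * (c * zeta + d))%C).
  { rewrite <- Hf at 2. field. exact Hden. }
  assert (Eb : b = (zeta * (c * zeta + d) - a * zeta)%C) by (rewrite <- Hq; ring).
  assert (Ha : (a - c * zeta)%C <> RtoC 0).
  { intros E. apply Hdet. rewrite Eb.
    transitivity ((a - c * zeta) * (d + c * zeta))%C; [ring|].
    rewrite E; ring. }
  set (zeta' := ((a - d) / c - zeta)%C).
  assert (Hz' : zeta' = zeta).
  { assert (H := proj1 (Hfix (Some zeta'))). simpl in H.
    unfold lft_eval, lft_num, lft_den in H; simpl in H.
    assert (Ed : (c * zeta' + d = a - c * zeta)%C) by (unfold zeta'; field; exact Hc).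
    rewrite Ed in H.
    destruct (Ceq_dec (a - c * zeta) 0) as [|_]; [contradiction|].
    assert (E : ((a * zeta' + b) / (a - c * zeta) = zeta')%C).
    { rewrite Eb. unfold zeta'. field. split; assumption. }
    rewrite E in H. specialize (H eq_refl). congruence. }
  assert (Ea : a = (d + 2 * c * zeta)%C).
  { transitivity (d + c * (zeta' + zeta))%C; [unfold zeta'; field; exact Hc|].
    rewrite Hz'. ring. }
  assert (Hs : (c * zeta + d)%C <> RtoC 0) by exact Hden.
  exists zeta, (- (c * zeta / (c * zeta + d)))%C.
  split; [exact Hz|].
  intros v Hv.
  assert (Hv0 : v <> RtoC 0) by (apply Re_neq_0; lra).
  assert (Hin : Cmod (zeta * (1 - / v)) < 1).
  { rewrite Cmod_mult, Hz, Rmult_1_l. now apply Cmod_1_minus_inv_lt_1. }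
  assert (Hd := self_map_den_neq_0 _ _ Hphi Hin).
  unfold lft_eval, lft_num, lft_den in *; simpl in *.
  set (s := (c * zeta + d)%C) in *.
  assert (Hvt : (v + - (c * zeta / s))%C <> RtoC 0).
  { intros E. apply Hd.
    transitivity (s / v * (v + - (c * zeta / s)))%C.
    - unfold s. field. split; assumption.
    - rewrite E; ring. }
  split; [exact Hvt|].
  assert (Hvt' : (s * v - c * zeta)%C <> RtoC 0).
  { intros E. apply Hvt. transitivity ((s * v - c * zeta) / s)%C;
      [field; exact Hs | rewrite E; field; exact Hs]. }
  assert (Ed : d = (s - c * zeta)%C) by (unfold s; ring).
  rewrite Eb, Ea. fold s. clearbody s. subst d.
  field. repeat split; try assumption.
  intros E; apply Hvt'. rewrite <- E. ring.
Qed.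

(** The translation maps [Re v > 1 / 2] into itself, so [Re t >= 0]; if [Re t = 0]
    it is onto, and [phi] is an automorphism. *)
Lemma parabolic_nonautomorphism_translation (phi : lft) (Hphi : self_map_of_disk phi) :
  parabolic phi -> ~ automorphism_of_disk phi ->
  exists zeta t : C, Cmod zeta = 1 /\ 0 < Re t /\
    forall v : C, 1 / 2 < Re v ->
      lft_eval phi (zeta * (1 - / v))%C = (zeta * (1 - / (v + t)))%C.
Proof.
  intros Hpar Hna.
  destruct (parabolic_translation phi Hphi Hpar) as [zeta [t [Hz Htr]]].
  exists zeta, t. split; [exact Hz|].
  assert (Hz0 : zeta <> RtoC 0) by (apply Cmod_gt_0; lra).
  assert (Hdisk : forall v, 1 / 2 < Re v -> Cmod (zeta * (1 - / v)) < 1).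
  { intros v Hv. rewrite Cmod_mult, Hz, Rmult_1_l.
    apply Cmod_1_minus_inv_lt_1; [apply Re_neq_0; lra | exact Hv]. }
  split; [|intros v Hv; apply Htr, Hv].
  assert (Hge : 0 <= Re t).
  { apply Rnot_lt_le; intros Hlt.
    (* A point within [|Re t|] of the boundary line, which [t] pushes across it. *)
    set (v := RtoC (1 / 2 - Re t / 2)).
    assert (Hv : 1 / 2 < Re v) by (unfold v; simpl; lra).
    destruct (Htr v Hv) as [Hnz E].
    assert (H := self_map_eval_lt_1 phi _ Hphi (Hdisk v Hv)).
    rewrite E, Cmod_mult, Hz, Rmult_1_l in H.
    apply Cmod_1_minus_inv_lt_1 in H; [|exact Hnz].
    unfold v, Re in *; simpl in *; lra. }
  destruct Hge as [H|H]; [exact H|exfalso].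
  apply Hna; intros q; split.
  - intros [w [-> Hw]].
    assert (Hw1 : (zeta - w)%C <> RtoC 0).
    { intros E. assert (E' : w = zeta).
      { transitivity (zeta - (zeta - w))%C; [ring | rewrite E; ring]. }
      rewrite E', Hz in Hw; lra. }
    set (u := (zeta / (zeta - w))%C).
    assert (Hu0 : u <> RtoC 0).
    { intros E. apply Hz0. transitivity (u * (zeta - w))%C;
        [unfold u; field; exact Hw1 | rewrite E; ring]. }
    assert (Ew : w = (zeta * (1 - / u))%C).
    { unfold u. field. split; assumption. }
    assert (Hu : 1 / 2 < Re u).
    { apply Cmod_1_minus_inv_lt_1; [exact Hu0|].
      rewrite Ew, Cmod_mult, Hz, Rmult_1_l in Hw. exact Hw. }
    assert (Hv : 1 / 2 < Re (u - t)%C).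
    { change (1 / 2 < Re u + - Re t). lra. }
    destruct (Htr _ Hv) as [_ E].
    exists (Some (zeta * (1 - / (u - t)))%C).
    split; [eexists; split; [reflexivity | apply Hdisk, Hv]|].
    simpl. destruct (Ceq_dec _ _) as [Ed|_].
    + exfalso; exact (self_map_den_neq_0 phi _ Hphi (Hdisk _ Hv) Ed).
    + rewrite E, Ew. do 5 f_equal. ring.
  - intros [p [Hp <-]]. apply Hphi, Hp.
Qed.

Lemma iter_composition (nu : R) (phi : lft) (Hphi : self_map_of_disk phi)
  (T : dirichlet nu -> dirichlet nu) :
  is_composition_operator nu phi Hphi T ->
  forall n f z, Nat.iter n T f z = f (Nat.iter n (disk_map phi Hphi) z).
Proof.
  intros HT n; induction n as [|n IH]; intros f z; [reflexivity|].
  rewrite (Nat.iter_succ_r n _ (disk_map phi Hphi)), <- IH. apply HT.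
Qed.

Lemma disk_origin_lt_1 : Cmod (RtoC 0) < 1.
Proof. rewrite Cmod_0; lra. Qed.

Definition orbit (phi : lft) (Hphi : self_map_of_disk phi) (m : nat) : disk :=
  Nat.iter m (disk_map phi Hphi)
    (exist (fun z : C => Cmod z < 1) (RtoC 0) disk_origin_lt_1).

Lemma orbit_disk_pt (phi : lft) (Hphi : self_map_of_disk phi) (zeta t : C) :
  0 < Re t ->
  (forall v : C, 1 / 2 < Re v ->
     lft_eval phi (zeta * (1 - / v))%C = (zeta * (1 - / (v + t)))%C) ->
  forall m, (orbit phi Hphi m : C) = (zeta * disk_pt t m)%C.
Proof.
  intros Ht H; induction m as [|m IH].
  - change (RtoC 0 = zeta * disk_pt t 0)%C.
    unfold disk_pt, half_plane_pt; simpl INR.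
    replace (1 + 0 * t)%C with (RtoC 1) by ring. field.
  - change (lft_eval phi (orbit phi Hphi m) = zeta * disk_pt t (S m))%C.
    rewrite IH. unfold disk_pt at 1. rewrite H.
    + unfold disk_pt. do 4 f_equal. unfold half_plane_pt. rewrite S_INR, RtoC_plus. ring.
    + unfold half_plane_pt, Re in *; simpl.
      assert (0 <= INR m * fst t) by (apply Rmult_le_pos; [apply pos_INR | lra]).
      lra.
Qed.

(** * A criterion for non-recurrence *)

Lemma open_dball (nu : R) (f : dirichlet nu) (eps : R) :
  open (fun g : dirichlet nu => dnorm (minus g f : dirichlet nu) < eps).
Proof.
  intros g Hg.
  assert (He : 0 < eps - dnorm (minus g f : dirichlet nu)) by lra.
  exists (mkposreal _ He). intros h Hh.
  change (dnorm (minus h g : dirichlet nu) < eps - dnorm (minus g f : dirichlet nu)) in Hh.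
  replace (minus h f) with (dplus (minus g f) (minus h g))
    by (apply dirichlet_eq; intros n; simpl; ring).
  assert (H := dnorm_triangle nu (minus g f) (minus h g)); lra.
Qed.

Lemma minus_eval (nu : R) (f g : dirichlet nu) (z : disk) :
  (minus f g : dirichlet nu) z = (f z - g z)%C.
Proof. simpl. ring. Qed.

Lemma common_radius (P : nat -> R -> Prop) :
  (forall n e e', e' <= e -> P n e -> P n e') ->
  (forall n, exists e, 0 < e /\ P n e) ->
  forall N, exists e, 0 < e /\ forall n, (n < N)%nat -> P n e.
Proof.
  intros Hmono HP; induction N as [|N [e [He IH]]].
  - exists 1; split; [lra | intros n Hn; lia].
  - destruct (HP N) as [e' [He' H']].
    exists (Rmin e e'). split; [now apply Rmin_glb_lt|].
    intros n Hn. destruct (Nat.eq_dec n N) as [->|Hne].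
    + apply Hmono with (2 := H'), Rmin_r.
    + apply Hmono with (e := e); [apply Rmin_l | apply IH; lia].
Qed.

Definition bounded_functional {nu : R} (ell : dirichlet nu -> C) : Prop :=
  (forall f g, ell (minus f g) = (ell f - ell g)%C) /\
  exists E : R, 0 <= E /\ forall f, Cmod (ell f) <= E * dnorm f.

(** A single return of a neighbourhood of [f0] must be ruled out for every time
    [n > 0].  Large times are handled by [ell], which vanishes asymptotically along
    orbits but not at [f0]; each of the finitely many small times is handled by a
    pair of functionals witnessing [T ^ n f0 <> f0], which stand in for the
    continuity of [T ^ n]. *)
Lemma not_recurrent_of_vanishing_functional (nu : R)
  (T : dirichlet nu -> dirichlet nu) (f0 : dirichlet nu) (ell : dirichlet nu -> C) :
  bounded_functional ell -> ell f0 <> RtoC 0 ->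
  (forall e : R, 0 < e -> exists N : nat, forall (n : nat) (f : dirichlet nu),
     (N <= n)%nat -> Cmod (ell (Nat.iter n T f)) <= e * dnorm f) ->
  (forall n : nat, (0 < n)%nat -> exists a b : dirichlet nu -> C,
     bounded_functional a /\ bounded_functional b /\
     (forall f, b (Nat.iter n T f) = a f) /\ a f0 <> b f0) ->
  ~ recurrent T.
Proof.
  intros [Hlin [A [HA Hbd]]] Hell Hdecay Hsep.
  set (l := Cmod (ell f0)).
  assert (Hl : 0 < l) by (apply Cmod_gt_0, Hell).
  assert (Hf0 := dnorm_ge_0 nu f0).
  destruct (Hdecay (l / (4 * (dnorm f0 + 1)))) as [N HN].
  { apply Rdiv_lt_0_compat; lra. }
  set (P := fun n e => (0 < n)%nat -> forall g : dirichlet nu,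
              dnorm (minus g f0 : dirichlet nu) < e ->
              dnorm (minus (Nat.iter n T g) f0 : dirichlet nu) < e -> False).
  assert (HP : exists e, 0 < e /\ forall n, (n < N)%nat -> P n e).
  { apply common_radius.
    - intros n e e' Hee HPe Hn g H1 H2. apply (HPe Hn g); lra.
    - intros n. destruct n as [|n].
      { exists 1. split; [lra|]. intros Hn; lia. }
      destruct (Hsep (S n)) as [a [b [[Ha [Ea [HEa Ha']]] [[Hb [Eb [HEb Hb']]] [Hab Hne]]]]];
        [lia|].
      set (dist := Cmod (a f0 - b f0)).
      assert (Hdist : 0 < dist).
      { apply Cmod_gt_0. intros E. apply Hne.
        transitivity ((a f0 - b f0) + b f0)%C; [ring | rewrite E; ring]. }
      set (e := dist / (Ea + Eb + 1)).
      assert (Ee : e * (Ea + Eb + 1) = dist) by (unfold e; field; lra).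
      assert (He : 0 < e) by (apply Rdiv_lt_0_compat; lra).
      exists e. split; [exact He|].
      intros _ g H1 H2.
      assert (B1 := Ha' (minus g f0)).
      assert (B2 := Hb' (minus (Nat.iter (S n) T g) f0)).
      rewrite Ha in B1. rewrite Hb, Hab in B2.
      assert (D1 : Ea * dnorm (minus g f0 : dirichlet nu) <= Ea * e)
        by (apply Rmult_le_compat_l; lra).
      assert (D2 : Eb * dnorm (minus (Nat.iter (S n) T g) f0 : dirichlet nu) <= Eb * e)
        by (apply Rmult_le_compat_l; lra).
      assert (Htri : dist <= Cmod (a g - a f0) + Cmod (a g - b f0)).
      { unfold dist. rewrite <- (Cmod_opp (a g - a f0)), Rplus_comm.
        replace (a f0 - b f0)%C with ((a g - b f0) + - (a g - a f0))%C by ring.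
        apply Cmod_triangle. }
      lra. }
  destruct HP as [e1 [He1 HP]].
  set (eps := Rmin (Rmin e1 1) (l / (2 * (A + 1)))).
  assert (Heps : 0 < eps).
  { repeat apply Rmin_glb_lt; try lra. apply Rdiv_lt_0_compat; lra. }
  assert (Heps1 : eps <= e1) by (eapply Rle_trans; [apply Rmin_l | apply Rmin_l]).
  assert (Heps2 : eps <= 1) by (eapply Rle_trans; [apply Rmin_l | apply Rmin_r]).
  assert (Heps3 : eps * (A + 1) <= l / 2).
  { apply Rle_trans with (l / (2 * (A + 1)) * (A + 1)).
    - apply Rmult_le_compat_r; [lra | apply Rmin_r].
    - apply Req_le. field. lra. }
  intros Hrec.
  assert (Hret : exists n, (0 < n)%nat /\ exists g : dirichlet nu,
            dnorm (minus g f0 : dirichlet nu) < eps /\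
            dnorm (minus (Nat.iter n T g) f0 : dirichlet nu) < eps).
  { apply (Hrec _ (open_dball nu f0 eps)).
    exists f0. replace (minus f0 f0) with (dscal 0%C f0)
      by (apply dirichlet_eq; intros i; simpl; ring).
    rewrite dnorm_scal, Cmod_0. lra. }
  destruct Hret as [n [Hn [g [Hg Hg']]]].
  destruct (Nat.lt_ge_cases n N) as [HnN|HnN].
  - apply (HP n HnN Hn g); lra.
  - assert (Hgn : dnorm g <= dnorm f0 + 1).
    { replace g with (dplus f0 (minus g f0)) at 1
        by (apply dirichlet_eq; intros i; simpl; ring).
      assert (H := dnorm_triangle nu f0 (minus g f0)). lra. }
    set (h := Nat.iter n T g) in *.
    assert (B1 := HN n g HnN). fold h in B1.
    assert (B2 := Hbd (minus h f0)). rewrite Hlin in B2.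
    assert (Hsmall : l / (4 * (dnorm f0 + 1)) * dnorm g <= l / 4).
    { apply Rle_trans with (l / (4 * (dnorm f0 + 1)) * (dnorm f0 + 1)).
      - apply Rmult_le_compat_l; [|exact Hgn].
        apply Rlt_le, Rdiv_lt_0_compat; lra.
      - apply Req_le. field. lra. }
    assert (Hclose : A * dnorm (minus h f0 : dirichlet nu) <= A * eps)
      by (apply Rmult_le_compat_l; lra).
    assert (Htri : l <= Cmod (ell h) + Cmod (ell h - ell f0)).
    { unfold l. rewrite <- (Cmod_opp (ell h - ell f0)).
      replace (ell f0) with (ell h + - (ell h - ell f0))%C at 1 by ring.
      apply Cmod_triangle. }
    lra.
Qed.

(** * The composition operator *)

Definition dident_coef (n : nat) : C := match n with 1%nat => RtoC 1 | _ => RtoC 0 end.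

Definition dident (nu : R) : dirichlet nu.
Proof.
  refine (Dirichlet (fun z => z : C) dident_coef _ _).
  - intros z. unfold is_pseries, is_series.
    apply filterlim_ext_loc with (fun _ : nat => z : C); [|apply filterlim_const].
    exists 1%nat. intros n Hn.
    induction Hn as [|n Hn IH].
    + rewrite sum_Sn, sum_O.
      change ((z : C) = (1 * 0 + z * 1 * 1)%C). ring.
    + rewrite sum_Sn, <- IH. destruct n as [|n]; [lia|].
      change ((z : C) = ((z : C) + (@pow_n C_AbsRing (z : C) (S (S n)) : C) * 0)%C). ring.
  - apply (ex_series_incr_n _ 2).
    apply ex_series_ext with (fun _ => 0); [|exact (ex_intro _ 0 is_series_R_0)].
    intros n. unfold wterm; simpl. rewrite Cmod_0.
    change (0 = 0 ^ 2 * weight nu (S (S n)) :> R). ring.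
Defined.

Theorem theorem5p14 (nu : R) (phi : lft) (Hphi : self_map_of_disk phi)
  (Hpar : parabolic phi) (Hna : ~ automorphism_of_disk phi)
  (T : dirichlet nu -> dirichlet nu)
  (HT : is_composition_operator nu phi Hphi T) :
  ~ recurrent T.
Proof.
  destruct (parabolic_nonautomorphism_translation phi Hphi Hpar Hna)
    as [zeta [t [Hz [Ht Htr]]]].
  assert (HZ := orbit_disk_pt phi Hphi zeta t Ht Htr).
  set (Z := orbit phi Hphi) in HZ.
  destruct (INR_unbounded (- nu)) as [p Hp'].
  assert (Hp : - nu <= INR p) by lra.
  assert (Ht0 : t <> RtoC 0) by (apply Re_neq_0, Ht).
  assert (Hz0 : zeta <> RtoC 0) by (apply Cmod_gt_0; lra).
  assert (Hv : forall m, half_plane_pt t m <> RtoC 0)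
    by (intros m; apply half_plane_pt_neq_0, Ht).
  assert (HF : forall (f : dirichlet nu) m, @is_pseries C_AbsRing C_NormedModule
                 (dcoef f) (zeta * disk_pt t m)%C (f (Z m))).
  { intros f m. rewrite <- HZ. apply dfun_expansion. }
  assert (Hiter : forall n f m, Nat.iter n T f (Z m) = f (Z (n + m)%nat)).
  { intros n f m. rewrite (iter_composition nu phi Hphi T HT). f_equal.
    unfold Z, orbit. symmetry. apply Nat.iter_add. }
  set (L := fun k n (f : dirichlet nu) => fdiff k (fun m => f (Z m)) n).
  assert (HLb : forall k n, bounded_functional (L k n)).
  { intros k n; split.
    - intros f g. unfold L. rewrite <- fdiff_minus.
      apply fdiff_ext; intros m. apply minus_eval.
    - destruct (fdiff_orbit_le nu p t zeta k Hp Ht Hz) as [A [HA HAb]].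
      exists (A * INR (S n) ^ S p * (/ INR (S n)) ^ k). split.
      + assert (HSn : 0 < INR (S n)) by (apply lt_0_INR; lia).
        apply Rmult_le_pos; [apply Rmult_le_pos; [exact HA | apply pow_le; lra]|].
        apply pow_le, Rlt_le, Rinv_0_lt_compat, HSn.
      + intros f. eapply Rle_trans; [apply HAb, HF|]. apply Req_le; ring. }
  apply (not_recurrent_of_vanishing_functional nu T (dident nu) (L (S (S p)) 0%nat)).
  - apply HLb.
  - unfold L.
    rewrite (fdiff_ext _ _ (fun m => (zeta * disk_pt t m)%C)) by exact HZ.
    rewrite fdiff_scal. apply Cmult_neq_0; [exact Hz0|].
    apply fdiff_disk_pt_neq_0; assumption.
  - intros e He.
    destruct (fdiff_orbit_le nu p t zeta (S (S p)) Hp Ht Hz) as [A [HA HAb]].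
    destruct (INR_unbounded (A / e)) as [N HN].
    exists N. intros n f HnN.
    assert (E : L (S (S p)) 0%nat (Nat.iter n T f) = L (S (S p)) n f).
    { unfold L. rewrite <- (fdiff_shift _ _ n). apply fdiff_ext; intros m. apply Hiter. }
    rewrite E.
    assert (HSn : 0 < INR (S n)) by (apply lt_0_INR; lia).
    eapply Rle_trans; [apply HAb, HF|].
    apply Rle_trans with (A / INR (S n) * dnorm f).
    + apply Req_le. rewrite <- (tech_pow_Rmult (/ INR (S n)) (S p)).
      transitivity (A / INR (S n) * dnorm f * (INR (S n) * / INR (S n)) ^ S p).
      * rewrite Rpow_mult_distr; unfold Rdiv; ring.
      * rewrite Rinv_r, pow1 by lra; ring.
    + apply Rmult_le_compat_r; [apply dnorm_ge_0|].
      apply Rle_div_l; [exact HSn|].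
      apply Rlt_div_l in HN; [|exact He].
      assert (HNn : INR N <= INR (S n)) by (apply le_INR; lia).
      assert (INR N * e <= INR (S n) * e) by (apply Rmult_le_compat_r; lra).
      lra.
  - intros n Hn. exists (L 0%nat n), (L 0%nat 0%nat).
    split; [apply HLb|]. split; [apply HLb|].
    split.
    + intros f. change (Nat.iter n T f (Z 0%nat) = f (Z n)).
      now rewrite Hiter, Nat.add_0_r.
    + change ((Z n : C) <> (Z 0%nat : C)). rewrite !HZ.
      intros E. apply (Cmult_neq_0 (INR n) t); [|exact Ht0|].
      * intros En. apply RtoC_inj in En. apply (not_0_INR n); [lia | exact En].
      * assert (Hn0 := Hv n). unfold disk_pt in E.
        replace (half_plane_pt t 0) with (RtoC 1) in E
          by (unfold half_plane_pt; simpl; ring).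
        transitivity (half_plane_pt t n * / zeta * (zeta * (1 - / half_plane_pt t n)))%C.
        -- unfold half_plane_pt in *. field. split; assumption.
        -- rewrite E. field. exact Hz0.
Qed.
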